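(* Let $\mathbf L=\langle L,\land,\lor,',0,1\rangle$ be a De Morgan bisemilattice. Let $X=\mathcal F(L)$ and $Y=\mathcal I(L)$, ordered by inclusion and topologized by the subbases $\{X_a\}_{a\in L}\cup\{\overline X_a\}_{a\in L}$ and $\{Y_a\}_{a\in L}\cup\{\overline Y_a\}_{a\in L}$, where: - $X_a=\{F\in X:a\in F\}$ and $\overline X_a=X\setminus X_a$; - $Y_a=\{I\in Y:a\in I\}$ and $\overline Y_a=Y\setminus Y_a$. Define $\rho(X_a)=\overline Y_a$, $(\overline Y_a)^\star=X_{a'}$ and $\overline 0=\overline Y_0$. Then $\langle X,\rho,{}^\star,Y\rangle$ is a 2space$^\star$.
   Context: **Bisemilattices.** A De Morgan bisemilattice is an algebra $\langle A,\land,\lor,',0,1\rangle$ such that: - $\land,\lor$ are idempotent, commutative and associative, and each distributes over the other; - $x\land1=x$, $x\lor0=x$ and $x''=x$; - $(x\land y)'=x'\lor y'$ and $(x\lor y)'=x'\land y'$. Write $a\le_\land b$ iff $a\land b=a$, and $a\le_\lor b$ iff $a\lor b=b$. Filters are nonempty subsets upward closed for $\le_\land$ and closed under $\land$; ideals are nonempty subsets downward closed for $\le_\lor$ and closed under $\lor$. **Fspaces.** An Fspace is a Stone space $X$ with a partial order $\le$ such that: (1) every subset has a greatest lower bound; (2) there is a clopen subbasis $\{X_i\}_{i\in I}\cup\{\overline X_i\}_{i\in I}$, where $X_i=\{x:x_i\le x\}$ for points $x_i$ and $\overline X_i=X\setminus X_i$; (3) every $x$ is the least upper bound of $\{x_i:x_i\le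 x\}$; (4) $X^*=\{X_i\}$ is closed under finite intersections. Put $\overline X^*=\{\overline X_i\}$. **2spaces and 2spaces$^\star$.** A 2space $\langle X,\rho,Y\rangle$ consists of: - Fspaces $X,Y$ with subbases $\{X_a\}\cup\{\overline X_a\}$ and $\{Y_a\}\cup\{\overline Y_a\}$ over a common index set $A$; - a bijection $\rho:X^*\to\overline Y^*$ with $\rho(X_a)=\overline Y_a$, satisfying $P\cap\rho^{-1}(\rho(Q)\cup\rho(R))=\rho^{-1}(\rho(P\cap Q)\cup\rho(P\cap R))$ for $P,Q,R\in X^*$, and $P\cup\rho(\rho^{-1}(Q)\cap\rho^{-1}(R))=\rho(\rho^{-1}(P\cup Q)\cap\rho^{-1}(P\cup R))$ for $P,Q,R\in\overline Y^*$. A 2space$^\star$ $\langle X,\rho,{}^\star,Y\rangle$ consists of: - a 2space $\langle X,\rho,Y\rangle$; - an inclusion-reversing order isomorphism ${}^\star:\overline Y^*\to X^*$ with ${}^\star\circ\rho=\rho^{-1}\circ({}^\star)^{-1}$; - a least element $\overline0$ of $\overline Y^*$. *)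

(* Defs.v *)
From HB Require Import structures.
From mathcomp Require Import all_boot all_order.
From mathcomp Require Import all_classical all_analysis.

Set Implicit Arguments.
Unset Strict Implicit.
Unset Printing Implicit Defensive.

Import Order.TTheory.
Local Open Scope classical_set_scope.

HB.mixin Record isDeMorganBisemilattice (L : Type) := {
  bmeet : L -> L -> L;
  bjoin : L -> L -> L;
  bneg : L -> L;
  bzero : L;
  bone : L;
  bmeetxx : idempotent_op bmeet;
  bmeetC : commutative bmeet;
  bmeetA : associative bmeet;
  bjoinxx : idempotent_op bjoin;
  bjoinC : commutative bjoin;
  bjoinA : associative bjoin;
  bmeet_joinr : right_distributive bmeet bjoin;
  bjoin_meetr : right_distributive bjoin bmeet;
  bmeetx1 : right_id bone bmeet;
  bjoinx0 : right_id bzero bjoin;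
  bnegK : involutive bneg;
  bneg_meet : {morph bneg : x y / bmeet x y >-> bjoin x y};
  bneg_join : {morph bneg : x y / bjoin x y >-> bmeet x y}
}.

#[short(type="deMorganBisemilatticeType")]
HB.structure Definition DeMorganBisemilattice :=
  { L of isDeMorganBisemilattice L }.

Arguments bzero {s}.
Arguments bone {s}.

Section FiltersIdeals.
Context {L : deMorganBisemilatticeType}.

(* The two orders are distinct in general: absorption is not assumed. *)
Definition le_meet (a b : L) : Prop := bmeet a b = a.
Definition le_join (a b : L) : Prop := bjoin a b = b.

Definition is_bfilter (F : set L) : Prop :=
  [/\ F !=set0,
      forall a b, F a -> le_meet a b -> F b
    & forall a b, F a -> F b -> F (bmeet a b)].

Definition is_bideal (I : set L) : Prop :=
  [/\ I !=set0,
      forall a b, I b -> le_join a b -> I a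
    & forall a b, I a -> I b -> I (bjoin a b)].

End FiltersIdeals.

(* Properness is not required: L itself is both a filter and an ideal. *)
Record bfilter (L : deMorganBisemilatticeType) := BFilter {
  bfilter_set :> set L;
  bfilter_prop : `[< is_bfilter bfilter_set >]
}.

Record bideal (L : deMorganBisemilatticeType) := BIdeal {
  bideal_set :> set L;
  bideal_prop : `[< is_bideal bideal_set >]
}.

(* The order inherited from [set L] is inclusion. *)
HB.instance Definition _ L := [isSub for @bfilter_set L].
HB.instance Definition _ L := [Choice of bfilter L by <:].
HB.instance Definition _ L :=
  [SubChoice_isSubPOrder of bfilter L by <: with set_display].

HB.instance Definition _ L := [isSub for @bideal_set L].
HB.instance Definition _ L := [Choice of bideal L by <:].
HB.instance Definition _ L :=
  [SubChoice_isSubPOrder of bideal L by <: with set_display].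

Definition filters_at (L : deMorganBisemilatticeType) (a : L) : set (bfilter L) :=
  [set F : bfilter L | (F : set L) a].

Definition ideals_at (L : deMorganBisemilatticeType) (a : L) : set (bideal L) :=
  [set I : bideal L | (I : set L) a].

Definition with_complements (T I : Type) (U : I -> set T) : set (set T) :=
  range U `|` range (fun i => ~` U i).

HB.instance Definition _ (L : deMorganBisemilatticeType) :=
  isSubBaseTopological.Build (bfilter L) (with_complements (@filters_at L)) id.

HB.instance Definition _ (L : deMorganBisemilatticeType) :=
  isSubBaseTopological.Build (bideal L) (with_complements (@ideals_at L)) id.

Definition subbasis (T : topologicalType) (S : set (set T)) : Prop :=
  basis (finI_from S id).

Definition stone_space (T : topologicalType) : Prop :=
  [/\ compact [set: T], hausdorff_space T & totally_disconnected [set: T]].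

(* The family [U] is the family $(X_i)_i$.  In [fspace_glb] the subset may be
   empty, so there is a greatest element; in [fspace_capI] the intersection may
   be empty, so the whole space is some [U i]. *)
Record is_fspace d (X : POrderedTopological.type d) (I : Type) (U : I -> set X)
    : Prop := {
  fspace_stone : stone_space X;
  fspace_glb : forall S : set X, exists m, infimums S m;
  fspace_clopen : with_complements U `<=` @clopen X;
  fspace_subbasis : subbasis (with_complements U);
  fspace_points : exists x_ : I -> X,
    (forall i, U i = [set x | (x_ i <= x)%O]) /\
    (forall x, supremums (x_ @` [set i | (x_ i <= x)%O]) x);
  fspace_capI : forall D : set (set X),
    finite_set D -> D `<=` range U -> range U (\bigcap_(P in D) P)
}.

Section TwoSpaces.
Context d1 (X : POrderedTopological.type d1) d2 (Y : POrderedTopological.type d2).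
Context (A : Type) (U : A -> set X) (V : A -> set Y).

(* $X^*$ and $\overline Y^*$. *)
Let Xs : set (set X) := range U.
Let Ys : set (set Y) := range (fun a => ~` V a).

(* Maps between $X^*$ and $\overline Y^*$ are total functions on sets of which
   only the restriction matters; likewise the partial inverses below are only
   used at elements of the image, so the default value [set0] is irrelevant. *)
Definition rho_inv (rho : set X -> set Y) : set Y -> set X :=
  'pinv_(fun=> set0) Xs rho.

Definition star_inv (star : set Y -> set X) : set X -> set Y :=
  'pinv_(fun=> set0) Ys star.

Record is_two_space (rho : set X -> set Y) : Prop := {
  two_space_l : is_fspace U;
  two_space_r : is_fspace V;
  two_space_bij : set_bij Xs Ys rho;
  two_space_rhoE : forall a, rho (U a) = ~` V a;
  two_space_distrI : forall P Q R, Xs P -> Xs Q -> Xs R ->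
    P `&` rho_inv rho (rho Q `|` rho R) =
    rho_inv rho (rho (P `&` Q) `|` rho (P `&` R));
  two_space_distrU : forall P Q R, Ys P -> Ys Q -> Ys R ->
    P `|` rho (rho_inv rho Q `&` rho_inv rho R) =
    rho (rho_inv rho (P `|` Q) `&` rho_inv rho (P `|` R))
}.

Record is_two_space_star (rho : set X -> set Y) (star : set Y -> set X)
    (zero : set Y) : Prop := {
  two_space_star_two_space : is_two_space rho;
  two_space_star_bij : set_bij Ys Xs star;
  two_space_star_anti : forall P Q, Ys P -> Ys Q ->
    (P `<=` Q <-> star Q `<=` star P);
  two_space_star_rho : forall P, Xs P ->
    star (rho P) = rho_inv rho (star_inv star P);
  two_space_star_zero : Ys zero;
  two_space_star_zero_le : forall P, Ys P -> zero `<=` P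
}.

End TwoSpaces.

(* Main.v *)
Require Import Defs.
From mathcomp Require Import all_boot all_order finmap.
From mathcomp Require Import all_classical all_analysis.

(** A filter is determined by the elements it contains, and the limit of an
    ultrafilter [F] on the space of filters is the filter of those [a] with
    [F (filters_at a)]; hence filters form a Stone space. Ideals are the filters
    of the semilattice of joins with unit [bzero], so both spaces are instances
    of one statement about semilattices with a unit. Principal filters and
    ideals make [filters_at] and [ideals_at] injective, which turns every axiom
    on rho and star into an identity of the bisemilattice, since [filters_at]
    sends meets to intersections and [~` ideals_at] sends joins to unions. *)

Set Implicit Arguments.
Unset Strict Implicit.
Unset Printing Implicit Defensive.

Import Order.TTheory.
Local Open Scope classical_set_scope.

(** * Open sets and convergence through a subbasis *)

Section Subbasis.
Context (T : topologicalType) (S : set (set T)).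

(** The hypothesis is the description of open sets in a topology generated from [S]; for filters and
    ideals it holds by computation. *)
Lemma subbasis_open_from :
  @open T = [set \bigcup_(B in D) B | D in subset^~ (finI_from S id)] ->
  subbasis S.
Proof.
move=> openE; split=> [B SB|x W /=].
  rewrite openE; exists [set B]; first by move=> _ ->.
  by rewrite bigcup_set1.
rewrite nbhsE => -[V [+ Vx] VW]; rewrite openE => -[D DS DV].
move: Vx; rewrite -DV => -[B DB Bx].
exists B; first by split=> //; exact: DS.
by apply: subset_trans VW; rewrite -DV; exact: bigcup_sup.
Qed.

Hypothesis S_subbasis : subbasis S.

Lemma subbasis_sub_open : S `<=` open.
Proof.
move=> A SA; apply: S_subbasis.1; exists [fset A]%fset => /=.
  by move=> B /fset1P ->; rewrite inE.
by rewrite set_fset1 bigcap_set1.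
Qed.

(** Subbasic sets suffice because a filter is closed under finite intersections. *)
Lemma subbasis_cvg (F : set_system T) (x : T) : Filter F ->
  (forall A, S A -> A x -> F A) -> F --> x.
Proof.
move=> FF FS W /(S_subbasis.2 x)[B [[D DS DB] Bx] BW].
apply: filterS BW _; move: Bx; rewrite -DB => Dx.
apply: filter_bigI => A AD; apply: FS; last exact: Dx.
by have := DS _ AD; rewrite inE.
Qed.

End Subbasis.

(** * Stone spaces from a subbasis closed under complements *)

Section StoneSpace.
Context (T : topologicalType) (I : Type) (U : I -> set T).
Hypothesis U_subbasis : subbasis (with_complements U).

Lemma subbasis_clopen : with_complements U `<=` @clopen T.
Proof.
have Uo i : open (U i) by apply: (subbasis_sub_open U_subbasis); left; exists i.
have UCo i : open (~` U i).
  by apply: (subbasis_sub_open U_subbasis); right; exists i.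
by move=> _ [[i _ <-]|[i _ <-]]; split=> //; rewrite -openC ?setCK.
Qed.

Lemma subbasis_stone_space :
  (forall x y, (forall i, U i x <-> U i y) -> x = y) ->
  (forall F : set_system T, UltraFilter F ->
     exists x, forall i, U i x <-> F (U i)) ->
  stone_space T.
Proof.
move=> U_inj U_lim.
(* If no clopen set contains [x] but not [y], then testing each [U i] and its complement shows that
   [x] and [y] lie in the same [U i]. *)
have sep (x y : T) : x != y -> exists A, [/\ clopen A, A x & ~ A y].
  move=> xy; apply: contrapT => nA; move/eqP: xy; apply; apply: U_inj => i.
  split=> Ui; apply: contrapT => nUi; apply: nA.
    by exists (U i); split=> //; apply: subbasis_clopen; left; exists i.
  exists (~` U i); split=> //.
  by apply: subbasis_clopen; right; exists i.
split; last exact: zero_dimension_totally_disconnected.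
- rewrite compact_ultra => F FU _; have [x Ux] := U_lim F FU; exists x; split=> //.
  apply: (subbasis_cvg U_subbasis) => _ [[i _ <-]|[i _ <-]]; first by move/Ux.
  by have [/Ux|//] := in_ultra_setVsetC (U i) FU.
- rewrite open_hausdorff => x y /sep[A [[Ao Ac] Ax nAy]].
  exists (A, ~` A) => /=; first by rewrite !inE.
  by split=> //; [exact: closed_openC | rewrite setICr].
Qed.

End StoneSpace.

(** * Fspaces of filters of a semilattice with unit *)

Section SemilatticeFspace.
Context d (X : POrderedTopological.type d) (I : Type) (U : I -> set X).
Context (op : I -> I -> I) (e : I).
Hypothesis opxx : idempotent_op op.
Hypothesis opC : commutative op.
Hypothesis opA : associative op.
Hypothesis opxe : right_id e op.

Hypothesis U_subbasis : subbasis (with_complements U).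
Hypothesis U_le : forall x y, (x <= y)%O <-> (forall i, U i x -> U i y).
Hypothesis U_unit : forall x, U e x.
Hypothesis U_op : forall x i j, U (op i j) x <-> U i x /\ U j x.
(** The conditions on [D] say that it is a filter for the order in which i is below j when
    [op j i = i]; every such filter comes from a point. *)
Hypothesis U_ex : forall D : set I,
  D e -> (forall i j, D (op i j) <-> D i /\ D j) ->
  exists x, forall i, U i x <-> D i.

Lemma U_principal i : exists x, forall j, U j x <-> op j i = i.
Proof.
apply: (U_ex (D := [set j | op j i = i])) => /=; first by rewrite opC opxe.
move=> j k; split=> [jki|[ji ki]]; last by rewrite -opA ki ji.
by split; rewrite -jki; [rewrite !opA opxx | rewrite (opC j) !opA opxx].
Qed.

(** An inclusion is tested at a single point, the one given by the principal filter of [i]. *)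
Lemma U_subset i j : U i `<=` U j <-> op j i = i.
Proof.
split=> [Uij|ji x]; last by rewrite -{1}ji => /U_op[].
have [x Ux] := U_principal i; apply/Ux/Uij/Ux; exact: opxx.
Qed.

Lemma semilattice_fspace : is_fspace U.
Proof.
have U_inj x y : (forall i, U i x <-> U i y) -> x = y.
  by move=> xy; apply/le_anti/andP; split; apply/U_le => i /xy.
split=> //.
- apply: (subbasis_stone_space U_subbasis) => // F FU.
  apply: (U_ex (D := fun i => F (U i))).
    by apply: filterS filterT => x _; exact: U_unit.
  move=> i j; split=> [Fij|[Fi Fj]].
    by split; apply: filterS Fij => x /U_op[].
  by apply: filterS (filterI Fi Fj) => x Uij; exact/U_op.
- move=> S.
  (* The infimum is the intersection of the filters in [S]; for empty [S] this is all of [I]. *)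
  have [|i j|m Um] := U_ex (D := [set i | forall x, S x -> U i x]).
  + by move=> x _; exact: U_unit.
  + split=> [Sij|[Si Sj] x Sx]; last by apply/U_op; split; [exact: Si|exact: Sj].
    by split=> x /Sij/U_op[].
  exists m; split=> [x Sx|x Sx]; apply/U_le => i.
    by move/Um; apply.
  by move=> Uix; apply/Um => y /Sx /U_le; apply.
- exact: subbasis_clopen U_subbasis.
- have [x_ Ux] := choice U_principal.
  (* The principal point of [i] is the least point of [U i]. *)
  have x_le i x : (x_ i <= x)%O <-> U i x.
    split=> [/U_le|Uix]; first by apply; apply/Ux; exact: opxx.
    by apply/U_le => j /Ux ji; move: Uix; rewrite -ji => /U_op[].
  exists x_; split=> [i|x].
    by apply/seteqP; split=> x /x_le.
  split=> [_ [i /= + <-]//|y yub].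
  apply/U_le => i /x_le xi; apply/x_le; apply: yub; by exists i.
(* The empty intersection is [U e]; each further set contributes one [op]. *)
- move=> D /finite_seqP[s ->]; elim: s => [|P s IHs] sU.
    exists e => //; apply/seteqP; split=> x // _; exact: U_unit.
  have [|i _ Ui] := sU P; first by rewrite /= mem_head.
  have [|j _ Uj] := IHs; first by move=> Q sQ; apply: sU; rewrite /= inE sQ orbT.
  exists (op i j) => //; rewrite bigcap_seq big_cons -bigcap_seq -Ui -Uj.
  by apply/seteqP; split=> x /U_op.
Qed.

End SemilatticeFspace.

(** * The two instances: filters under meet, ideals under join *)

Section FiltersIdeals.
Context (L : deMorganBisemilatticeType).
Implicit Types a b : L.

Lemma bfilterP (F : bfilter L) : is_bfilter (F : set L).
Proof. exact/asboolP/(bfilter_prop F). Qed.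

Lemma bidealP (J : bideal L) : is_bideal (J : set L).
Proof. exact/asboolP/(bideal_prop J). Qed.

Lemma filters_at1 (F : bfilter L) : filters_at bone F.
Proof.
by have [[a Fa] Fup _] := bfilterP F; apply: Fup Fa _; exact: bmeetx1.
Qed.

Lemma filters_at_meet (F : bfilter L) a b :
  filters_at (bmeet a b) F <-> filters_at a F /\ filters_at b F.
Proof.
have [_ Fup Fmeet] := bfilterP F; split=> [Fab|[Fa Fb]]; last exact: Fmeet.
split; apply: Fup Fab _; rewrite /le_meet; last by rewrite -bmeetA bmeetxx.
by rewrite bmeetC bmeetA bmeetxx.
Qed.

(** Upward closure is hidden in the equivalence: [le_meet a b] rewrites [a] as [bmeet a b], so [b]
    lies in [D] as soon as [a] does. *)
Lemma bfilter_ex (D : set L) :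
  D bone -> (forall a b, D (bmeet a b) <-> D a /\ D b) ->
  exists F : bfilter L, forall a, filters_at a F <-> D a.
Proof.
move=> D1 Dmeet; have /asboolP DF : is_bfilter D.
  split; [by exists bone| |by move=> a b Da Db; exact/Dmeet].
  by move=> a b + ab; rewrite -ab => /Dmeet[].
by exists (BFilter DF).
Qed.

Lemma ideals_at0 (J : bideal L) : ideals_at bzero J.
Proof.
have [[a Ja] Jdown _] := bidealP J; apply: Jdown Ja _.
by rewrite /le_join bjoinC bjoinx0.
Qed.

Lemma ideals_at_join (J : bideal L) a b :
  ideals_at (bjoin a b) J <-> ideals_at a J /\ ideals_at b J.
Proof.
have [_ Jdown Jjoin] := bidealP J; split=> [Jab|[Ja Jb]]; last exact: Jjoin.
split; apply: Jdown Jab _; rewrite /le_join; first by rewrite bjoinA bjoinxx.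
by rewrite bjoinC -bjoinA bjoinxx.
Qed.

Lemma bideal_ex (D : set L) :
  D bzero -> (forall a b, D (bjoin a b) <-> D a /\ D b) ->
  exists J : bideal L, forall a, ideals_at a J <-> D a.
Proof.
move=> D0 Djoin; have /asboolP DJ : is_bideal D.
  split; [by exists bzero| |by move=> a b Da Db; exact/Djoin].
  by move=> a b + ab; rewrite -ab => /Djoin[].
by exists (BIdeal DJ).
Qed.

Lemma filters_at_fspace : is_fspace (@filters_at L).
Proof.
apply: (semilattice_fspace bmeetxx bmeetC bmeetA bmeetx1).
- exact: subbasis_open_from.
- by move=> F G; rewrite Order.SubPreorderTheory.leEsub subsetEset.
- exact: filters_at1.
- exact: filters_at_meet.
- exact: bfilter_ex.
Qed.

Lemma ideals_at_fspace : is_fspace (@ideals_at L).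
Proof.
apply: (semilattice_fspace bjoinxx bjoinC bjoinA bjoinx0).
- exact: subbasis_open_from.
- by move=> F G; rewrite Order.SubPreorderTheory.leEsub subsetEset.
- exact: ideals_at0.
- exact: ideals_at_join.
- exact: bideal_ex.
Qed.

Lemma filters_at_subset a b : filters_at a `<=` filters_at b <-> bmeet b a = a.
Proof.
exact: (U_subset bmeetxx bmeetC bmeetA bmeetx1 filters_at_meet bfilter_ex).
Qed.

(** The order is reversed: an element larger for [le_join] lies in fewer ideals. *)
Lemma ideals_at_subset a b : ideals_at a `<=` ideals_at b <-> bjoin b a = a.
Proof.
exact: (U_subset bjoinxx bjoinC bjoinA bjoinx0 ideals_at_join bideal_ex).
Qed.

Lemma filters_at_inj : injective (@filters_at L).
Proof.
move=> a b ab; have /filters_at_subset <- : filters_at a `<=` filters_at b.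
  by rewrite ab.
by rewrite bmeetC; apply/filters_at_subset; rewrite ab.
Qed.

Lemma ideals_at_inj : injective (@ideals_at L).
Proof.
move=> a b ab; have /ideals_at_subset <- : ideals_at a `<=` ideals_at b.
  by rewrite ab.
by rewrite bjoinC; apply/ideals_at_subset; rewrite ab.
Qed.

Lemma filters_atI a b :
  filters_at a `&` filters_at b = filters_at (bmeet a b).
Proof. by apply/seteqP; split=> F /filters_at_meet. Qed.

Lemma ideals_atCU a b :
  ~` ideals_at a `|` ~` ideals_at b = ~` ideals_at (bjoin a b).
Proof.
by rewrite -setCI; congr (~` _); apply/seteqP; split=> J /ideals_at_join.
Qed.

End FiltersIdeals.

(** Well-definedness of a map prescribed on the values of [f]; [y0] is its value elsewhere. *)
Lemma factor_injective (A T1 T2 : Type) (f : A -> T1) (g : A -> T2) (y0 : T2) :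
  injective f -> exists h : T1 -> T2, forall a, h (f a) = g a.
Proof.
move=> f_inj.
have /choice[h hP] : forall x, exists y, forall a, f a = x -> y = g a.
  move=> x; have [[a fa]|nx] := pselect (exists a, f a = x).
    by exists (g a) => b fb; congr g; apply: f_inj; rewrite fa fb.
  by exists y0 => a fa; case: nx; exists a.
by exists h => a; exact: hP.
Qed.

(* The two equations are the definitions of rho and star; they determine both
   maps on the sets where they matter, and their solvability is the
   well-definedness of rho and star. *)
Theorem theorem7p3 (L : deMorganBisemilatticeType) :
  exists (rho : set (bfilter L) -> set (bideal L))
         (star : set (bideal L) -> set (bfilter L)),
    [/\ forall a : L, rho (filters_at a) = ~` ideals_at a,
        forall a : L, star (~` ideals_at a) = filters_at (bneg a)
      & is_two_space_star (@filters_at L) (@ideals_at L) rho star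
          (~` ideals_at bzero)].
Proof.
have idealsC_inj : injective (fun a : L => ~` ideals_at a).
  by move=> a b /setC_inj/ideals_at_inj.
have [rho rhoE] := factor_injective (fun a => ~` ideals_at a) set0
  (@filters_at_inj L).
have [star starE] := factor_injective (fun a => filters_at (bneg a)) set0
  idealsC_inj.
have rho_bij : set_bij (range (@filters_at L))
    (range (fun a : L => ~` ideals_at a)) rho.
  split=> [_ [a _ <-]|P Q|_ [a _ <-]].
  - by rewrite rhoE; exists a.
  - rewrite !inE => -[a _ <-] [b _ <-].
    by rewrite !rhoE => /idealsC_inj ->.
  - by exists (filters_at a); [exists a|rewrite rhoE].
have star_bij : set_bij (range (fun a : L => ~` ideals_at a))
    (range (@filters_at L)) star.
  split=> [_ [a _ <-]|P Q|_ [a _ <-]].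
  - by rewrite starE; exists (bneg a).
  - rewrite !inE => -[a _ <-] [b _ <-].
    by rewrite !starE => /filters_at_inj/(can_inj bnegK) ->.
  - by exists (~` ideals_at (bneg a)); [exists (bneg a)|rewrite starE bnegK].
have rho_invE a : rho_inv (@filters_at L) rho (~` ideals_at a) = filters_at a.
  rewrite -rhoE; apply: (pinvKV _ (set_bij_inj rho_bij)).
  by rewrite inE; exists a.
have star_invE a :
    star_inv (@ideals_at L) star (filters_at a) = ~` ideals_at (bneg a).
  rewrite -{1}(bnegK a) -starE; apply: (pinvKV _ (set_bij_inj star_bij)).
  by rewrite inE; exists (bneg a).
exists rho, star; split=> //; split=> //.
- split=> //; [exact: filters_at_fspace|exact: ideals_at_fspace| |].
  (* Both sides become [filters_at] of an element, and the elements agree by distributivity of meet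
     over join; the next case is dual. *)
  + move=> _ _ _ [a _ <-] [b _ <-] [c _ <-].
    by rewrite !(rhoE, filters_atI, ideals_atCU, rho_invE) bmeet_joinr.
  + move=> _ _ _ [a _ <-] [b _ <-] [c _ <-].
    by rewrite !(ideals_atCU, rho_invE, filters_atI, rhoE) bjoin_meetr.
(* Both inclusions say that [b] is above [a]: on the left for [le_join], on the right, through
   [bneg], for the meet order reversed. *)
- move=> _ _ [a _ <-] [b _ <-]; rewrite !starE.
  split=> [/subsetCP/ideals_at_subset ab|/filters_at_subset ba].
    by apply/filters_at_subset; rewrite -bneg_join ab.
  apply/subsetCP/ideals_at_subset; apply: (can_inj bnegK).
  by rewrite bneg_join.
(* Both composites send [filters_at a] to [filters_at (bneg a)]. *)
- by move=> _ [a _ <-]; rewrite star_invE rhoE starE rho_invE.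
(* Every ideal contains [bzero], so the proposed least element is the empty set. *)
- by move=> P _ J nJ0; case: nJ0; exact: ideals_at0.
Qed.
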